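(* Let $B$ be a generalized Bratteli diagram with incidence matrices $F_n$, $n\in\mathbb N_0$, and let $\mu$ be a probability tail-invariant measure on $B$. Let $A_n=F_n^T$. Then there exist a sequence of numbers $\lambda_n>1$, a sequence of vectors $\widehat\mu^{(n)}=(\widehat\mu^{(n)}_v)_{v\in V_n}$, and a sequence of vectors $\widehat H^{(n)}=(\widehat H^{(n)}_v)_{v\in V_n}$ such that for every $n\in\mathbb N_0$ (1) $\langle\widehat\mu^{(n)},\widehat H^{(n)}\rangle=1$, (2) $A_n\widehat\mu^{(n+1)}=\lambda_n\widehat\mu^{(n)}$, (3) $F_n\widehat H^{(n)}=\lambda_n\widehat H^{(n+1)}$. Conversely, suppose there exist a sequence of non-negative infinite integer matrices $A_n$ with finite column sums, a sequence of numbers $\lambda_n>1$, a sequence of non-negative infinite vectors $\widehat\mu^{(n)}=(\widehat\mu^{(n)}_v)$, and a sequence of positive infinite vectors $\widehat H^{(n)}=(\widehat H^{(n)}_v)$ with $\widehat H^{(0)}=H^{(0)}$, which satisfy conditions (1)-(3) above (with $F_n=A_n^T$) for every $n\in\mathbb N_0$. Then a generalized Bratteli diagram $B$ defined by the incidence matrices $F_n=A_n^T$ possesses a probability tail-invariant measure $\mu$ for which the measures of cylinder sets are defined by the sequence of vectors $$p^{(0)}=\widehat\mu^{(0)}\quad\text{and}\quad p^{(n)}=\frac1{\lambda_0\cdots\lambda_{n-1}}\widehat\mu^{(n)}\ \text{ for } n\ge1,$$ where $p^{(n)}=(p^{(n)}_w)_{w\in V_n}$ and $p^{(n)}_w=\mu([\overline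 e])$ for any finite path $\overline e$ from $V_0$ to $w\in V_n$.
   Context: $\mathbb N_0=\{0,1,2,\dots\}$. A generalized Bratteli diagram is a graded graph $B=(V,E)$ with $V=\bigsqcup_{i\ge0}V_i$, $E=\bigsqcup_{i\ge0}E_i$, every level $V_i$ countably infinite, $E_i$ a countable set of edges from $V_i$ to $V_{i+1}$ with source and range maps $s,r$, $s(E_i)=V_i$, $r(E_i)=V_{i+1}$, $|r^{-1}(v)|<\infty$ for $v\in V\setminus V_0$. The incidence matrix $F_n=(f^{(n)}_{v,w})$, $v\in V_{n+1}$, $w\in V_n$, has $f^{(n)}_{v,w}$ equal to the number of edges from $w$ to $v$; so each row of $F_n$ has finitely many nonzero entries and no row or column is zero. The path space $X_B$ is the set of infinite paths $x=(x_i)_{i\ge0}$, $x_i\in E_i$, $r(x_i)=s(x_{i+1})$, with the topology generated by the cylinder sets $[\overline e]=\{x: x_0=e_0,\dots,x_{n-1}=e_{n-1}\}$ (for $w\in V_0$, the path of length $0$ at $w$ gives the set $\{x:s(x_0)=w\}$). Standing assumptions: $X_B$ has no isolated points, all classes of the tail equivalence relation ($x\sim y$ iff $x_i=y_i$ for all large $i$) are infinite, and $B$ is connected as an undirected graph. A (positive non-atomic Borel) measure $\mu$ on $X_B$ is tail-invariant if $\mu([\overline e])=\mu([\overline e'])$ for any finite paths $\overline e,\overline e'$ from $V_0$ with $r(\overline e)=r(\overline e')$. $H^{(0)}=(1,1,1,\dots)$, indexed by $V_0$. $\langle x,y\rangle=\sum_{v}x_vy_v$. *)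

(* Defs.v *)
From HB Require Import structures.
From Stdlib Require Relation_Operators.
From mathcomp Require Import all_boot all_order all_algebra finmap.
From mathcomp Require Import all_classical all_reals all_analysis.
From mathcomp.analysis.showcase Require summability.

Set Implicit Arguments.
Unset Strict Implicit.
Unset Printing Implicit Defensive.

Import Order.TTheory GRing.Theory Num.Theory.
Import numFieldNormedType.Exports.

Local Open Scope classical_set_scope.
Local Open Scope ring_scope.

(* Sum of a real family over a countable index set, as the limit of the net of
   its finite partial sums (equivalently, absolute convergence).  [esum] is not
   used because on signed families it is the supremum of the finite sums. *)
Definition has_sum (R : realType) (I : choiceType) (x : I -> R) (l : R) : Prop :=
  summability.partial_sum x @ @summability.totally I --> l.

Definition imx_tr (I J : Type) (M : I -> J -> nat) : J -> I -> nat :=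
  fun j i => M i j.

(* [M x = y], convergence of every row sum included. *)
Definition imx_apply (R : realType) (I : Type) (J : choiceType)
    (M : I -> J -> nat) (x : J -> R) (y : I -> R) : Prop :=
  forall i, has_sum (fun j => (M i j)%:R * x j) (y i).

Record gbd (V : nat -> countType) := Gbd {
  edge : nat -> countType;
  src : forall n, edge n -> V n;
  tgt : forall n, edge n -> V n.+1;
  vertex_infinite : forall n, infinite_set [set: V n];
  src_surj : forall n, range (@src n) = [set: V n];
  tgt_surj : forall n, range (@tgt n) = [set: V n.+1];
  tgt_fiber_finite : forall n (v : V n.+1), finite_set [set e | @tgt n e = v]
}.

Definition incidence (V : nat -> countType) (B : gbd V) (n : nat)
    (v : V n.+1) (w : V n) : nat :=
  #|` fset_set [set e : edge B n | src e = w /\ tgt e = v] |.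

Record path_space (V : nat -> countType) (B : gbd V) := Path {
  path_edge :> forall n, edge B n;
  path_compat : forall n, tgt (path_edge n) = src (path_edge n.+1)
}.

Lemma path_space_inhabited (V : nat -> countType) (B : gbd V) :
  inhabited (path_space B).
Proof.
have [w _] : exists w : V 0%N, True.
  apply: contrapT => /forallNP Vnil; apply: (@vertex_infinite _ B 0%N).
  suff -> : [set: V 0%N] = set0 by exact: finite_set0.
  by apply/seteqP; split => w // _; exact: Vnil.
have next n (v : V n) : {e : edge B n | src e = v}.
  have : range (@src _ B n) v by rewrite src_surj.
  by move=> /cid2[e _ ev]; exists e.
pose vert := fix vert n : V n :=
  if n is m.+1 return V n then tgt (sval (next m (vert m))) else w.
by apply: (inhabits (@Path _ B (fun n => sval (next n (vert n)))
  (fun n => esym (svalP (next n.+1 (vert n.+1)))))).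
Qed.

HB.instance Definition _ (V : nat -> countType) (B : gbd V) :=
  gen_eqMixin (path_space B).
HB.instance Definition _ (V : nat -> countType) (B : gbd V) :=
  gen_choiceMixin (path_space B).
HB.instance Definition _ (V : nat -> countType) (B : gbd V) :=
  isPointed.Build (path_space B) (inhabited_witness (path_space_inhabited B)).

(* Finite paths from level 0, indexed by their length and their end vertex. *)
Inductive fin_path (V : nat -> countType) (B : gbd V) : forall n, V n -> Type :=
| fin_path0 (w : V 0%N) : fin_path B w
| fin_path_rcons n (e : edge B n) of fin_path B (src e) : fin_path B (tgt e).

Fixpoint cylinder (V : nat -> countType) (B : gbd V) n (w : V n)
    (p : fin_path B w) : set (path_space B) :=
  match p with
  | fin_path0 w0 => [set x | src (x 0%N) = w0]
  | fin_path_rcons m e q => cylinder q `&` [set x | x m = e]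
  end.

HB.instance Definition _ (V : nat -> countType) (B : gbd V) :=
  @isSubBaseTopological.Build (path_space B) (set (path_space B))
    [set C | exists n (w : V n) (p : fin_path B w), C = cylinder p] id.

Definition borel_path_space (V : nat -> countType) (B : gbd V) :=
  g_sigma_algebraType (@open (path_space B)).

HB.instance Definition _ (V : nat -> countType) (B : gbd V) :=
  Measurable.on (borel_path_space B).

Definition tail_equiv (V : nat -> countType) (B : gbd V)
    (x y : path_space B) : Prop :=
  exists N : nat, forall i, (N <= i)%N -> x i = y i.

Definition vertex_adj (V : nat -> countType) (B : gbd V)
    (u v : {n : nat & V n}) : Prop :=
  exists n (e : edge B n), u = Tagged V (src e) /\ v = Tagged V (tgt e).

Record standing_assumptions (V : nat -> countType) (B : gbd V) : Prop := {
  no_isolated_point : isolated [set: path_space B] = set0;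
  tail_class_infinite :
    forall x : path_space B, infinite_set [set y | tail_equiv x y];
  connected_diagram : forall u v,
    Relation_Operators.clos_refl_sym_trans {n : nat & V n} (vertex_adj B) u v
}.

Definition non_atomic d (T : measurableType d) (R : realType)
    (mu : set T -> \bar R) : Prop :=
  forall A, measurable A -> (0 < mu A)%E ->
    exists C, [/\ measurable C, C `<=` A & (0 < mu C < mu A)%E].

Definition tail_invariant (R : realType) (V : nat -> countType) (B : gbd V)
    (mu : set (path_space B) -> \bar R) : Prop :=
  forall n (w : V n) (p q : fin_path B w), mu (cylinder p) = mu (cylinder q).

Record eigen_conditions (R : realType) (V : nat -> countType)
    (A : forall n, V n -> V n.+1 -> nat) (lam : nat -> R)
    (muh Hh : forall n, V n -> R) : Prop := {
  pairing_eq1 : forall n, has_sum (fun v => muh n v * Hh n v) 1;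
  eigen_A : forall n,
    imx_apply (A n) (muh n.+1) (fun w => lam n * muh n w);
  eigen_F : forall n,
    imx_apply (imx_tr (A n)) (Hh n) (fun v => lam n * Hh n.+1 v)
}.

(* Main.v *)
Require Import Defs.
From HB Require Import structures.
From mathcomp Require Import all_boot all_order all_algebra finmap.
From mathcomp Require Import all_classical all_reals all_analysis.
From mathcomp.analysis.showcase Require summability.

Set Implicit Arguments.
Unset Strict Implicit.
Unset Printing Implicit Defensive.

Import Order.TTheory GRing.Theory Num.Theory.

Local Open Scope classical_set_scope.
Local Open Scope ring_scope.

(** Tail-invariant probability measures and pairs of eigenvector sequences are
    two descriptions of the same data, and the proof goes through the data
    itself: a system of coherent weights [W n v >= 0], the would-be common
    mass of the cylinders ending at [v] in [V n], such that the weight of [v]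
    is the sum of the weights of the ends of all edges leaving [v], and the
    weights of level 0 add up to 1.

    From a measure to weights ([weights_of_tail_invariant]): a cylinder is the
    countable disjoint union of its one-edge extensions. From weights to
    eigenvectors ([eigen_of_weights]): take [lam n = 2], scale the weights by
    [2 ^+ n], and scale by [2 ^- n] the numbers of finite paths ending at each
    vertex. The conditions [eigen_A] and [eigen_F] are then the splitting rule
    and the recursion for the number of paths; [pairing_eq1] says that the
    cylinders of each level have total mass 1, which passes from one level to
    the next by exchanging two sums over edges. In the other direction
    ([weights_of_eigen]) [eigen_A], divided by [lam 0 * .. * lam n], is the
    splitting rule, and [pairing_eq1] at level 0 is the normalization because
    the vector there is constant equal to 1.

    The substance of the converse is a measure with prescribed cylinder masses
    ([path_measure]). The path space is not compact, so additivity on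
    cylinders does not trivially give countable additivity. The mass is first
    defined on the algebra of the sets that depend on finitely many edges, by
    summing weights over one representative path of each prefix. If a set [A]
    of the algebra had a mass greater than the sum of the masses of countably
    many sets [F k] covering it, the same strict inequality would survive
    inside one of the cylinders of level 0, then inside one of its children,
    and so on; the resulting infinite path lies in [A], hence in some [F k],
    and a deep enough cylinder around it lies in [F k] entirely, which is
    absurd ([mass_sigma_subadditive]). Caratheodory extension then gives the
    measure.

    Non-atomicity comes from the infinite tail classes
    ([tail_invariant_non_atomic]). On an atom, one cylinder of each level
    carries all of its mass [c > 0]; these cylinders close down on a path [z],
    and by tail invariance every path tail equivalent to [z] is a point of
    mass at least [c]. Infinitely many such points do not fit into a
    probability measure. *)

(** * Prefixes and cylinders *)

Section path_combinatorics.
Context (V : nat -> countType) (B : gbd V).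
Implicit Types (x y z : path_space B) (A C : set (path_space B)).

(** Prefixes of paths are represented by the paths that start with them: this
    avoids the length- and vertex-indexed type of finite paths, in which
    equality of prefixes would require transports. The source has to be
    mentioned for the sake of [n = 0]. *)
Definition cyl n x : set (path_space B) :=
  [set y | src (y 0%N) = src (x 0%N) /\ forall i, (i < n)%N -> y i = x i].

(** Unlike the finite unions of cylinders, these sets form an algebra, and it
    generates the Borel sets. *)
Definition determined n A := forall x y, cyl n x y -> A x -> A y.

Lemma path_eq x y : (forall i, x i = y i) -> x = y.
Proof.
case: x y => [f cf] [g cg] /= fg.
have {}fg : f = g by apply: functional_extensionality_dep.
by subst g; rewrite (Prop_irrelevance cf cg).
Qed.

Lemma cyl_refl n x : cyl n x x. Proof. by []. Qed.
Hint Resolve cyl_refl : core.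

Lemma cyl_sym n x y : cyl n x y -> cyl n y x.
Proof. by move=> [s0 s]; split=> // i /s. Qed.

Lemma cyl_trans n x y z : cyl n x y -> cyl n y z -> cyl n x z.
Proof.
by move=> [xy0 xy] [yz0 yz]; split=> [|i iltn]; rewrite ?yz0// yz// xy.
Qed.

Lemma cyl_eq n x y : cyl n x y -> cyl n y = cyl n x.
Proof.
move=> xy; apply/seteqP; split=> z; first exact: cyl_trans.
by apply: cyl_trans; exact: cyl_sym.
Qed.

Lemma cylS n x : cyl n.+1 x = cyl n x `&` [set y | y n = x n].
Proof.
apply/seteqP; split=> y /= [].
  by move=> y0 yi; split; [split=> // i /ltnW/yi|exact: yi].
move=> [y0 yi] yn; split=> // i; rewrite ltnS leq_eqVlt => /predU1P[->//|].
exact: yi.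
Qed.

Lemma sub_cyl m n x : (m <= n)%N -> cyl n x `<=` cyl m x.
Proof. by move=> mn y [y0 yi]; split=> // i im; apply/yi/(leq_trans im). Qed.

Lemma cyl_src n x y : cyl n x y -> src (y n) = src (x n).
Proof.
by case: n => [[]//|n] [_ yi]; rewrite -!path_compat yi.
Qed.

Lemma cyl0E x y : cyl 0 x y <-> src (y 0%N) = src (x 0%N).
Proof. by split=> [[]//|]; split. Qed.

Lemma determined_cyl n x : determined n (cyl n x).
Proof. by move=> y z yz xy; exact: cyl_trans yz. Qed.

Lemma determined_edge n (e : edge B n) : determined n.+1 [set x | x n = e].
Proof. by move=> x y [_ yi] /= <-; exact: yi. Qed.

Lemma determined_source (v : V 0%N) :
  determined 0 [set x : path_space B | src (x 0%N) = v].
Proof. by move=> x y [+ _] /= => ->. Qed.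

Lemma determined_leq m n A : (m <= n)%N -> determined m A -> determined n A.
Proof. by move=> mn dA x y /(sub_cyl mn); exact: dA. Qed.

Lemma determined0 n : determined n set0. Proof. by []. Qed.

Lemma determinedT n : determined n setT. Proof. by []. Qed.

Lemma determinedC n A : determined n A -> determined n (~` A).
Proof. by move=> dA x y /cyl_sym xy nAx Ay; apply/nAx/(dA _ _ xy). Qed.

Lemma determinedU n A C :
  determined n A -> determined n C -> determined n (A `|` C).
Proof. by move=> dA dC x y xy [/(dA _ _ xy)|/(dC _ _ xy)]; [left|right]. Qed.

Lemma determinedI n A C :
  determined n A -> determined n C -> determined n (A `&` C).
Proof. by move=> dA dC x y xy [/(dA _ _ xy)? /(dC _ _ xy)]. Qed.

(** A path may be built by choosing an edge out of every vertex once and for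
    all. *)
Lemma selector_path (sel : forall i, V i -> edge B i) (v : V 0%N) :
  (forall i u, src (sel i u) = u) ->
  exists y, src (y 0%N) = v /\ forall i, y i = sel i (src (y i)).
Proof.
move=> selP.
pose vert := fix vert n : V n :=
  if n is m.+1 return V n then tgt (sel m (vert m)) else v.
have cy n : tgt (sel n (vert n)) = src (sel n.+1 (vert n.+1)) by rewrite selP.
by exists (Path cy); split=> [|i] /=; rewrite selP.
Qed.

Lemma path_from (v : V 0%N) : exists x : path_space B, src (x 0%N) = v.
Proof.
have next i (u : V i) : {e : edge B i | src e = u}.
  have : range (@src _ B i) u by rewrite src_surj.
  by move=> /cid2[e _ eu]; exists e.
have [|x [x0 _]] := @selector_path (fun i u => sval (next i u)) v.
  by move=> i u; exact: (svalP (next i u)).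
by exists x.
Qed.

(** The path is produced by a selector that follows [x] below level [n] and
    takes [e] at the source of [e]. Since the level is a bound variable of the
    selector, [e] can only be compared with an edge of that level as a tagged
    pair. *)
Lemma extend_prefix n x (e : edge B n) : src e = src (x n) ->
  exists y, cyl n x y /\ y n = e.
Proof.
move=> ex.
have next i (u : V i) : {a : edge B i | [/\ src a = u,
    (i < n)%N -> u = src (x i) -> a = x i &
    Tagged V u = Tagged V (src e) -> Tagged (edge B) a = Tagged (edge B) e]}.
  apply: cid; have [ne|ne] := pselect (Tagged V u = Tagged V (src e)).
    have ine : i = n by case: ne.
    subst i; exists e; split => //; last by rewrite ltnn.
    by move/eqP : ne; rewrite eq_Tagged /= => /eqP ->.
  have [ux|ux] := pselect (u = src (x i)).
    by subst u; exists (x i); split.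
  have : range (@src _ B i) u by rewrite src_surj.
  by move=> [a _ au]; exists a; split.
have [|y [y0 yS]] :=
    @selector_path (fun i u => sval (next i u)) (src (x 0%N)).
  by move=> i u; case: (svalP (next i u)).
have yi i : (i < n)%N -> src (y i) = src (x i) -> y i = x i.
  by move=> iltn yxi; rewrite (yS i); case: (svalP (next i (src (y i)))) => _ ->.
have ys i : (i <= n)%N -> src (y i) = src (x i).
  elim: i => [//|i IHi] ilen.
  by rewrite -!path_compat yi// IHi// ltnW.
exists y; split; first by split=> // i iltn; rewrite yi// ys// ltnW.
suff /eqP : Tagged (edge B) (y n) = Tagged (edge B) e.
  by rewrite eq_Tagged => /eqP.
rewrite (yS n); case: (svalP (next n (src (y n)))) => _ _; apply.
by rewrite ys// ex.
Qed.

Lemma vertex_reached n (v : V n) : exists x : path_space B, src (x n) = v.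
Proof.
elim: n v => [|n IHn] v; first exact: path_from.
have : range (@tgt _ B n) v by rewrite tgt_surj.
move=> [e _ <-]; have [x /esym xe] := IHn (src e).
by have [y [_ ye]] := extend_prefix xe; exists y; rewrite -path_compat ye.
Qed.

(** With [cyl_cylinder], this identifies the cylinders of finite paths with
    the sets [cyl n x]. *)
Lemma cylinder_cyl n (w : V n) (p : fin_path B w) :
  exists2 x : path_space B, src (x n) = w & cylinder p = cyl n x.
Proof.
elim: p => {n w} [w|n e q [x xe cq]] /=.
  have [x xw] := path_from w; exists x => //.
  by apply/seteqP; split=> y; [move=> /= yw; apply/cyl0E; rewrite yw|
     move=> /cyl0E /= ->].
have [y [xy ye]] := extend_prefix (esym xe).
exists y; first by rewrite -path_compat ye.
by rewrite cq cylS (cyl_eq xy) ye.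
Qed.

Lemma cyl_cylinder n x :
  exists w (p : fin_path B w), w = src (x n) /\ cylinder p = cyl n x.
Proof.
elim: n => [|n [w [p [wx cp]]]].
  exists (src (x 0%N)), (fin_path0 B (src (x 0%N))); split=> //.
  by apply/seteqP; split=> y /cyl0E.
subst w; exists (tgt (x n)), (fin_path_rcons p).
by split; [exact: path_compat|rewrite cylS /= cp].
Qed.

(** Dependent choice along the levels: the path takes its [i]-th edge from the
    prefix of length [i + 1], which all later prefixes extend. This is where
    the absence of compactness is overcome, both for countable additivity and
    for non-atomicity. *)
Lemma path_of_prefixes (P : nat -> set (path_space B) -> Prop) :
  (exists x, P 0 (cyl 0 x)) ->
  (forall n x, P n (cyl n x) -> exists2 y, cyl n x y & P n.+1 (cyl n.+1 y)) ->
  exists z, forall n, P n (cyl n z).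
Proof.
move=> [x0 P0] PS.
have next n x : {y | P n (cyl n x) -> cyl n x y /\ P n.+1 (cyl n.+1 y)}.
  apply: cid; have [/PS[y xy Py]|] := pselect (P n (cyl n x)); first by exists y.
  by exists x.
pose s := fix s n := if n is m.+1 then sval (next m (s m)) else x0.
have sP n : P n (cyl n (s n)).
  by elim: n => [//|n /(svalP (next n (s n)))[]].
have sS n : cyl n (s n) (s n.+1) by have [] := svalP (next n (s n)) (sP n).
have slate m n : (m <= n)%N -> cyl m (s m) (s n).
  move=> /subnKC <-; elim: (n - m)%N => [|k IH]; first by rewrite addn0.
  by rewrite addnS; apply: (cyl_trans IH); exact/(sub_cyl (leq_addr _ _))/sS.
have cz i : tgt (s i.+1 i) = src (s i.+2 i.+1).
  by rewrite path_compat (cyl_src (sS i.+1)).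
exists (Path cz) => n; rewrite (@cyl_eq n (s n))//; split.
  by rewrite /= (cyl_src (slate 0 1 _))// (cyl_src (slate 0 n _)).
move=> i iltn /=; have [_ /(_ i)] := slate i.+1 n iltn.
by move=> ->.
Qed.

End path_combinatorics.
#[global] Hint Resolve cyl_refl : core.

(** * Sums of nonnegative families *)

#[local] Existing Instance summability.totally_filter.

Section nonnegative_sums.
Context (R : realType).
Local Open Scope ereal_scope.

Lemma esum_fiber (I J : choiceType) (f : I -> J) (A : set I) (a : I -> \bar R) :
  (forall i, A i -> 0 <= a i) ->
  \esum_(i in A) a i = \esum_(j in [set: J]) \esum_(i in A `&` f @^-1` [set j]) a i.
Proof.
move=> a0; rewrite esum_esum//; last by move=> j i _ [/a0].
rewrite (reindex_esum A _ (fun i => (f i, i)))//; split=> /=.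
- by move=> i Ai; split.
- by move=> i j _ _ [].
- by move=> [j i] /= [_ [Ai fij]]; exists i => //; rewrite fij.
Qed.

Lemma esum_exchange (I J : choiceType) (a : I -> J -> \bar R) :
  (forall i j, 0 <= a i j) ->
  \esum_(i in [set: I]) \esum_(j in [set: J]) a i j =
  \esum_(j in [set: J]) \esum_(i in [set: I]) a i j.
Proof.
move=> a0; rewrite !esum_esum//.
rewrite (reindex_esum ([set: J] `*`` (fun=> [set: I])) _ (fun x => (x.2, x.1)))//.
split=> //=.
- by move=> [j1 i1] [j2 i2] _ _ [-> ->].
- by move=> [i j] _; exists (j, i).
Qed.

Lemma esumZl (I : choiceType) (A : set I) (a : I -> \bar R) (c : R) :
  (0 <= c)%R -> (forall i, 0 <= a i) ->
  \esum_(i in A) (c%:E * a i) = c%:E * \esum_(i in A) a i.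
Proof.
move=> + a0; rewrite le_eqVlt => /predU1P[<-|c0].
  by rewrite mul0e esum1// => i _; rewrite mul0e.
have le k (b : I -> \bar R) : (0 < k)%R -> (forall i, 0 <= b i) ->
    \esum_(i in A) (k%:E * b i) <= k%:E * \esum_(i in A) b i.
  move=> k0 b0; apply: ge_ereal_sup => _ /= [X [finX XA] <-].
  rewrite fsbig_finite//= -ge0_sume_distrr//.
  rewrite lee_pmul2l//; apply: esum_ge; exists X => //.
  by rewrite fsbig_finite.
apply/eqP; rewrite eq_le le//=.
rewrite -lee_pdivlMl// (le_trans _ (le _ _ _ _))//; last 2 first.
  by rewrite invr_gt0.
  by move=> i; rewrite mule_ge0// ?a0// lee_fin ltW.
apply: le_esum => i Ai.
by rewrite muleA -EFinM mulVf ?gt_eqF// mul1e.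
Qed.

Lemma esum_const (I : choiceType) (A : set I) (c : R) :
  (0 <= c)%R -> finite_set A ->
  \esum_(i in A) c%:E = ((#|` fset_set A|)%:R * c)%:E.
Proof.
move=> c0 finA; rewrite esum_fset// fsbig_finite//= sumEFin.
by rewrite big_const_seq count_predT iter_addr_0 mulr_natl.
Qed.

Lemma partial_sumE (I : choiceType) (x : I -> R) (F : {fset I}) :
  summability.partial_sum x F = (\sum_(i <- F) x i)%R.
Proof. by rewrite /summability.partial_sum big_seq_fsetE. Qed.

(** For nonnegative families the net of finite sums converges to its supremum,
    so that sums can be rearranged in the extended reals, where no convergence
    has to be checked. *)
Lemma has_sum_esum (I : choiceType) (x : I -> R) (l : R) :
  (forall i, (0 <= x i)%R) ->
  has_sum x l <-> \esum_(i in [set: I]) (x i)%:E = l%:E.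
Proof.
move=> x0.
have psum_le (F G : {fset I}) : (F `<=` G)%fset ->
    (summability.partial_sum x F <= summability.partial_sum x G)%R.
  move=> FG; rewrite !partial_sumE.
  rewrite (big_fsetID _ (mem F) G)/= (_ : [fset i in G | i \in F]%fset = F).
    by rewrite lerDl sumr_ge0.
  by apply/fsetP => i; rewrite !inE andb_idl//; move/fsubsetP : FG; exact.
have psumE (X : set I) : finite_set X -> \sum_(i \in X) (x i)%:E =
    (summability.partial_sum x (fset_set X))%:E.
  by move=> finX; rewrite fsbig_finite//= sumEFin partial_sumE.
split.
- move=> /cvgrPdist_lt xl; apply/eqP; rewrite eq_le; apply/andP; split.
    apply: ge_ereal_sup => _ /= [X [finX _] <-]; rewrite psumE// lee_fin.
    apply/ler_addgt0Pr => e e0; have [F _ Fl] := xl _ e0.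
    have /= := Fl (F `|` fset_set X)%fset (fsubsetUl _ _).
    rewrite ltr_distlC => /andP[_ /ltW].
    by apply: le_trans; apply: psum_le; exact: fsubsetUr.
  apply/lee_addgt0Pr => e e0; have [F _ Fl] := xl _ e0.
  have /= := Fl F (fsubset_refl _); rewrite ltr_distl => /andP[_ /ltW lF].
  rewrite (@le_trans _ _ (summability.partial_sum x F + e)%:E)//.
  rewrite EFinD leeD2r//; apply: esum_ge; exists [set` F].
    by split; [exact: finite_fset|].
  by rewrite psumE ?set_fsetK//; exact: finite_fset.
- move=> xl; apply/cvgrPdist_lt => e e0.
  have : (l - e)%:E < \esum_(i in [set: I]) (x i)%:E.
    by rewrite xl lte_fin ltrBlDr ltrDl.
  move=> /ereal_sup_gt[_ [X [finX _] <-]]; rewrite psumE// lte_fin => lX.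
  exists (fset_set X) => // F /= XF.
  have Fl : (summability.partial_sum x F <= l)%R.
    rewrite -lee_fin -xl; apply: esum_ge; exists [set` F].
      by split; [exact: finite_fset|].
    by rewrite psumE ?set_fsetK//; exact: finite_fset.
  rewrite ltr_distlC (lt_le_trans lX (psum_le _ _ XF))/=.
  by rewrite (le_lt_trans Fl)// ltrDl.
Qed.

End nonnegative_sums.

(** * Coherent weights and eigenvectors *)

(** The masses that a tail-invariant probability measure gives to the
    cylinders, as a function of the end vertex. *)
Record coherent_weights (R : realType) (V : nat -> countType) (B : gbd V) :=
  CoherentWeights {
  wt :> forall n, V n -> R;
  wt_ge0 : forall n (v : V n), 0 <= wt v;
  wt_split : forall n (v : V n),
    (\esum_(e in [set e : edge B n | src e = v]) (wt (tgt e))%:E =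
     (wt v)%:E)%E;
  wt_total : (\esum_(v in [set: V 0%N]) (wt v)%:E = 1)%E
}.

Arguments wt {R V B} W n v : rename.

Section weights_and_eigenvectors.
Context (R : realType) (V : nat -> countType) (B : gbd V).
Implicit Types (W : coherent_weights R B).

(** Summing over edges instead of over vertices with multiplicities turns
    products with the incidence matrices into sums over the fibers of [src]
    and [tgt]. *)
Lemma esum_edges_from n (v : V n) (g : V n.+1 -> R) : (forall u, 0 <= g u) ->
  (\esum_(e in [set e : edge B n | src e = v]) (g (tgt e))%:E =
   \esum_(u in [set: V n.+1]) ((incidence B u v)%:R * g u)%:E)%E.
Proof.
move=> g0; rewrite (@esum_fiber R _ _ (@tgt _ B n)); last first.
  by move=> e _; rewrite lee_fin.
apply: eq_esum => u _; rewrite -esum_const//.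
  by apply: eq_esum => e [_ /= ->].
by apply: sub_finite_set (@tgt_fiber_finite _ B n u) => e [].
Qed.

Lemma esum_edges_to n (u : V n.+1) (g : V n -> R) : (forall v, 0 <= g v) ->
  (\esum_(e in [set e : edge B n | tgt e = u]) (g (src e))%:E =
   \esum_(v in [set: V n]) ((incidence B u v)%:R * g v)%:E)%E.
Proof.
move=> g0; rewrite (@esum_fiber R _ _ (@src _ B n)); last first.
  by move=> e _; rewrite lee_fin.
apply: eq_esum => v _.
rewrite (_ : _ `&` _ = [set e : edge B n | src e = v /\ tgt e = u]); last first.
  by apply/seteqP; split=> e [].
rewrite -esum_const//.
  by apply: eq_esum => e [/= -> _].
by apply: sub_finite_set (@tgt_fiber_finite _ B n u) => e [].
Qed.

(** The number of finite paths from level 0 that end at the vertex. *)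
Fixpoint height n : V n -> R :=
  match n with
  | 0 => fun=> 1
  | m.+1 => fun u =>
      \sum_(e <- fset_set [set e : edge B m | tgt e = u]) height (src e)
  end.

Lemma height_ge0 n (v : V n) : 0 <= height v.
Proof. by elim: n v => [//|n IHn] v /=; apply: sumr_ge0. Qed.

Lemma heightS n (u : V n.+1) :
  (\esum_(e in [set e : edge B n | tgt e = u]) (height (src e))%:E =
   (height u)%:E)%E.
Proof.
have finu := @tgt_fiber_finite _ B n u.
rewrite esum_fset//=; last by move=> e _; rewrite lee_fin height_ge0.
by rewrite fsbig_finite//= sumEFin.
Qed.

(** The cylinders of level [n] have total mass 1. For the induction, the sum
    at level [n + 1] is a sum over all edges between the two levels, which is
    grouped by the target on one side and by the source on the other. *)
Lemma weights_heights W n :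
  (\esum_(v in [set: V n]) (W n v * height v)%:E = 1)%E.
Proof.
have W0 := wt_ge0 W; elim: n => [|n <-].
  by rewrite -(wt_total W); apply: eq_esum => v _; rewrite mulr1.
transitivity (\esum_(e in [set: edge B n])
    (W n.+1 (tgt e) * height (src e))%:E)%E.
  rewrite (@esum_fiber R _ _ (@tgt _ B n)); last first.
    by move=> e _; rewrite lee_fin mulr_ge0// height_ge0.
  apply: eq_esum => u _; rewrite EFinM -heightS -esumZl//; last first.
    by move=> e; rewrite lee_fin height_ge0.
  by rewrite setTI; apply: eq_esum => e /= ->.
rewrite (@esum_fiber R _ _ (@src _ B n)); last first.
  by move=> e _; rewrite lee_fin mulr_ge0// height_ge0.
apply: eq_esum => v _; rewrite mulrC EFinM -wt_split -esumZl//; last 2 first.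
  exact: height_ge0.
  by move=> e; rewrite lee_fin.
by rewrite setTI; apply: eq_esum => e /= ->; rewrite -EFinM mulrC.
Qed.

(** Any [lam n > 1] would do, as the scalings of the two vectors compensate
    each other. *)
Lemma eigen_of_weights W :
  eigen_conditions (fun n => imx_tr (@incidence V B n)) (fun=> 2)
    (fun n v => 2 ^+ n * W n v) (fun n v => 2 ^- n * height v).
Proof.
have W0 := wt_ge0 W.
have e0 n : 0 <= 2 ^+ n :> R by rewrite exprn_ge0.
split=> n; [|move=> v|move=> v].
- apply/has_sum_esum => [v|].
    by rewrite !mulr_ge0 ?invr_ge0// height_ge0.
  rewrite -(weights_heights W n); apply: eq_esum => v _.
  by rewrite mulrACA divff ?mul1r// expf_neq0.
- apply/has_sum_esum => [u|]; first by rewrite !mulr_ge0.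
  rewrite mulrA -exprS EFinM -wt_split esum_edges_from// -esumZl//; last first.
    by move=> u; rewrite lee_fin mulr_ge0.
  by apply: eq_esum => u _; rewrite -EFinM mulrCA.
- apply/has_sum_esum => [w|]; first by rewrite !mulr_ge0 ?invr_ge0// height_ge0.
  rewrite mulrA exprS invfM mulVKf// EFinM -heightS esum_edges_to; last first.
    exact: height_ge0.
  rewrite -esumZl ?invr_ge0//; last first.
    by move=> w; rewrite lee_fin mulr_ge0// height_ge0.
  by apply: eq_esum => w _; rewrite -EFinM mulrCA.
Qed.

Lemma weights_of_eigen (A : forall n, V n -> V n.+1 -> nat) (lam : nat -> R)
    (muh Hh : forall n, V n -> R) :
  (forall n, 0 < lam n) -> (forall n v, 0 <= muh n v) ->
  (forall v, Hh 0%N v = 1) -> eigen_conditions A lam muh Hh ->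
  (forall n, @incidence V B n = imx_tr (A n)) ->
  {W : coherent_weights R B |
    forall n v, W n v = (\prod_(i < n) lam i)^-1 * muh n v}.
Proof.
move=> lam0 muh0 Hh0 [muH Amuh _] FA.
pose w n v := (\prod_(i < n) lam i)^-1 * muh n v.
have prod0 n : 0 <= (\prod_(i < n) lam i)^-1.
  by rewrite invr_ge0 prodr_ge0// => i _; exact: ltW.
have w0 n v : 0 <= w n v by rewrite mulr_ge0.
unshelve eexists (@CoherentWeights R V B w w0 _ _) => //.
- move=> n v; rewrite esum_edges_from//.
  have /has_sum_esum : forall u, 0 <= (A n v u)%:R * muh n.+1 u.
    by move=> u; rewrite mulr_ge0.
  move=> /(_ (lam n * muh n v))[/(_ (Amuh n v)) Esum _].
  have -> : w n v = (\prod_(i < n.+1) lam i)^-1 * (lam n * muh n v).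
    by rewrite big_ord_recr invfM -mulrA mulKf// lt0r_neq0.
  rewrite EFinM -Esum -esumZl//; last first.
    by move=> u; rewrite lee_fin mulr_ge0.
  by apply: eq_esum => u _; rewrite FA /w /imx_tr -EFinM mulrCA.
- have /has_sum_esum : forall v, 0 <= muh 0%N v * Hh 0%N v.
    by move=> v; rewrite Hh0 mulr1.
  move=> /(_ 1)[/(_ (muH 0%N)) Esum _].
  rewrite -[RHS]Esum; apply: eq_esum => v _.
  by rewrite /w big_ord0 invr1 mul1r Hh0 mulr1.
Qed.

End weights_and_eigenvectors.

(** * From a tail-invariant measure to weights *)

Lemma measure_bigcup_countType d (T : measurableType d) (R : realType)
    (mu : {measure set T -> \bar R}) (I : countType) (F : I -> set T) :
  (forall i, measurable (F i)) -> trivIset setT F ->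
  (mu (\bigcup_i F i) = \esum_(i in [set: I]) mu (F i))%E.
Proof.
move=> mF tF; pose G k := if @pickle_inv I k is Some i then F i else set0.
have GF i : G (choice.pickle i) = F i by rewrite /G pickleK_inv.
have GK k i : @pickle_inv I k = Some i -> choice.pickle i = k.
  by move=> ki; have := @pickle_invK I k; rewrite ki.
have G0 k : ~ range (@choice.pickle I) k -> G k = set0.
  rewrite /G; case E : (@pickle_inv I k) => [i|//] []; exists i => //.
  exact: GK.
have -> : \bigcup_i F i = \bigcup_k G k.
  apply/seteqP; split=> x [i _]; last first.
    by rewrite /G; case: pickle_inv => // j Fx; exists j.
  by rewrite -GF => Gx; exists (choice.pickle i).
(* The sequence G enumerates the family, with empty sets at unused indices. *)
rewrite measure_bigcup//; last 2 first.
  by move=> k _; rewrite /G; case: pickle_inv => [i|]//; exact: mF.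
  move=> k l _ _; rewrite /G.
  case Ek : (@pickle_inv I k) => [i|]; last by move=> [x []].
  case El : (@pickle_inv I l) => [j|]; last by move=> [x []].
  by move=> /tF ij; rewrite -(GK _ _ Ek) -(GK _ _ El) ij.
rewrite nneseries_esum; last by move=> *; exact: measure_ge0.
transitivity (\esum_(k in range (@choice.pickle I)) mu (G k))%E.
  rewrite [RHS]esum_mkcond; under eq_set do rewrite in_setT.
  rewrite set_true; apply: eq_esum => k _.
  by case: ifPn => //; rewrite notin_setE => /G0 ->; rewrite measure0.
rewrite esum_image; last by move=> i j _ _; exact: (pcan_inj choice.pickleK).
by apply: eq_esum => i _; rewrite GF.
Qed.

Section borel_structure.
Context (V : nat -> countType) (B : gbd V).
Implicit Types (x y z : path_space B) (A C : set (path_space B)).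

Lemma open_cyl n x : open (cyl n x).
Proof.
have [w [p [_ <-]]] := cyl_cylinder n x.
exists [set cylinder p]; last by rewrite bigcup_set1.
move=> _ ->; exists [fset cylinder p]%fset; last by rewrite set_fset1 bigcap_set1.
by move=> C /fset1P ->; apply/mem_set; exists n, w, p.
Qed.

Lemma open_determined n A : determined n A -> open A.
Proof.
move=> dA; suff -> : A = \bigcup_(x in A) cyl n x.
  by apply: bigcup_open => x _; exact: open_cyl.
apply/seteqP; split=> [x Ax|y [x Ax xy]]; first by exists x.
exact: dA xy Ax.
Qed.

Lemma borel_determined n A :
  determined n A -> measurable (A : set (borel_path_space B)).
Proof. by move=> dA; apply: sub_sigma_algebra; exact: open_determined dA. Qed.

(** The cylinders are given as a subbase only, but finitely many cylinders
    around [x] are nested, so the longest of them is contained in their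
    intersection. *)
Lemma open_cyl_sub (U : set (path_space B)) x :
  open U -> U x -> exists n, cyl n x `<=` U.
Proof.
move=> [D DsB <-] [C DC Cx]; have [K Kcyl CK] := DsB C DC.
have {Kcyl} Kcyl C' : exists n, C' \in K -> cyl n x `<=` C'.
  have [C'K|] := pselect (C' \in K); last by exists 0.
  have /set_mem[n [w [p C'p]]] := Kcyl _ C'K.
  have [y _ py] := cylinder_cyl p; exists n => _; rewrite C'p py.
  have := Cx; rewrite -[X in X x]/C -CK => /(_ C' C'K).
  rewrite /= C'p py => yx.
  by rewrite (cyl_eq yx).
have [N NK] := choice Kcyl.
exists (\max_(C' <- K) N C') => y xy; exists C => //; change (C y).
rewrite -CK => C' C'K.
by apply: (NK C') => //; apply: sub_cyl xy; exact: leq_bigmax_seq.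
Qed.

(** The [n]-th set is the union of the cylinders of level [n] contained in
    [U]. In this form the union is countable even though a level may have
    infinitely many cylinders. *)
Lemma open_bigcup_determined (U : set (path_space B)) : open U ->
  exists2 F, (forall n, determined n (F n)) & U = \bigcup_n F n.
Proof.
move=> oU; exists (fun n => [set x | cyl n x `<=` U]).
  by move=> n x y xy /=; rewrite (cyl_eq xy).
apply/seteqP; split=> [x /(open_cyl_sub oU)[n xU]|x [n _]]; first by exists n.
by apply; exact: cyl_refl.
Qed.

Context (R : realType) (mu : {measure set (borel_path_space B) -> \bar R}).

Lemma measure_split_edges n (A : set (borel_path_space B)) : measurable A ->
  (mu A = \esum_(e in [set: edge B n]) mu (A `&` [set x | x n = e]))%E.
Proof.
move=> mA; rewrite -measure_bigcup_countType.
- congr (mu _); apply/seteqP; split=> [x Ax|x [e _ []]//].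
  by exists (x n).
- move=> e; apply: measurableI => //.
  exact: borel_determined (@determined_edge _ B n e).
- by move=> e f _ _ [x [[_ /= <-] [_ /= <-]]].
Qed.

Lemma measure_split_sources (A : set (borel_path_space B)) : measurable A ->
  (mu A = \esum_(v in [set: V 0%N])
    mu (A `&` [set x : path_space B | src (x 0%N) = v]))%E.
Proof.
move=> mA; rewrite -measure_bigcup_countType.
- congr (mu _); apply/seteqP; split=> [x Ax|x [e _ []]//].
  by exists (src (x 0%N)).
- move=> v; apply: measurableI => //.
  exact: borel_determined (@determined_source _ B v).
- by move=> e f _ _ [x [[_ /= <-] [_ /= <-]]].
Qed.

Lemma tail_invariant_cyl n x y : tail_invariant mu ->
  src (x n) = src (y n) -> mu (cyl n x) = mu (cyl n y).
Proof.
move=> ti xy; have [u [p [ux <-]]] := cyl_cylinder n x.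
have [w [q [wy <-]]] := cyl_cylinder n y.
by rewrite xy -wy in ux; subst u; exact: ti.
Qed.
End borel_structure.

Lemma weights_of_tail_invariant (R : realType) (V : nat -> countType)
    (B : gbd V) (mu : probability (borel_path_space B) R) :
  tail_invariant mu -> inhabited (coherent_weights R B).
Proof.
move=> ti.
pose rho n (v : V n) : path_space B := sval (cid (vertex_reached B v)).
have rhoP n (v : V n) : src (rho n v n) = v := svalP (cid (vertex_reached B v)).
pose p n v := fine (mu (cyl n (rho n v))).
have mcyl n x : measurable (cyl n x : set (borel_path_space B)).
  exact: borel_determined (determined_cyl (n := n) (x := x)).
have pE n x : mu (cyl n x) = (p n (src (x n)))%:E.
  rewrite /p fineK ?fin_num_measure//.
  by apply: tail_invariant_cyl => //; rewrite rhoP.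
have p0 n v : 0 <= p n v by apply: fine_ge0; exact: measure_ge0.
constructor; unshelve eexists p => //.
- move=> n v; have <- := rhoP n v; rewrite -pE.
  set x := rho n v.
  rewrite (measure_split_edges mu n (mcyl n x)) esum_mkcond.
  apply: eq_esum => e _; case: ifPn => [/set_mem /= ex|].
    have [y [xy ye]] := extend_prefix ex.
    by rewrite -(cyl_eq xy) -ye -cylS pE path_compat.
  rewrite notin_setE /= => ex; rewrite (_ : _ `&` _ = set0) ?measure0//.
  by apply/seteqP; split=> // y [xy /= ye]; apply: ex; rewrite -ye (cyl_src xy).
- rewrite -(probability_setT mu) (measure_split_sources mu measurableT).
  apply: eq_esum => v _; rewrite setTI -[in LHS](rhoP 0%N v) -pE.
  congr (mu _); apply/seteqP; split=> y.
    by move=> /cyl0E /=; rewrite rhoP.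
  by move=> /= yv; apply/cyl0E; rewrite rhoP.
Qed.

(** * Non-atomicity *)

Section non_atomicity.
Context (R : realType) (V : nat -> countType) (B : gbd V).
Context (mu : probability (borel_path_space B) R).
Implicit Types (x y z : path_space B).
Local Open Scope ereal_scope.

Let borel_cyl n x : measurable (cyl n x : set (borel_path_space B)).
Proof. exact: borel_determined (determined_cyl (n := n) (x := x)). Qed.

Lemma bigcap_cyl x : \bigcap_n cyl n x = [set x].
Proof.
apply/seteqP; split=> [y xy|_ -> n _]; last exact: cyl_refl.
apply: path_eq => i; have [_] := xy i.+1 I.
by apply; exact: leqnn.
Qed.

Lemma borel_point x : measurable ([set x] : set (borel_path_space B)).
Proof. by rewrite -bigcap_cyl; exact: bigcapT_measurable. Qed.

(** From some level on, [y] and [z] pass through the same vertices, so their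
    cylinders have the same mass; the point [y] is the decreasing intersection
    of its cylinders. *)
Lemma tail_invariant_point_ge (c : \bar R) z y : tail_invariant mu ->
  (forall n, c <= mu (cyl n z)) -> tail_equiv z y -> c <= mu [set y].
Proof.
move=> ti cz [N zy].
have cvg_mu : mu \o (fun n => cyl n y) @ \oo --> mu [set y].
  rewrite -bigcap_cyl; apply: nonincreasing_cvg_mu => //.
  - by rewrite -ge0_fin_numE ?fin_num_measure.
  - exact: bigcapT_measurable.
  - by move=> m n mn; apply/subsetPset; exact: sub_cyl.
rewrite -(cvg_lim _ cvg_mu)//; apply: lime_ge.
  by apply/cvg_ex; eexists; exact: cvg_mu.
near=> n; rewrite /= (tail_invariant_cyl (y := z))//; first exact: cz.
by rewrite zy//; near: n; exact: nbhs_infty_ge.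
Unshelve. all: by end_near. Qed.

(** Otherwise every point of the tail class of [z] would have mass at least
    [c]. *)
Lemma infinite_tail_class_cyl_lt z : tail_invariant mu ->
  infinite_set [set y | tail_equiv z y] ->
  forall c, 0 < c -> exists n, mu (cyl n z) < c.
Proof.
move=> ti infz c c0; apply: contrapT => /forallNP cz.
have {}cz n : c <= mu (cyl n z) by rewrite leNgt; apply/negP; exact: cz.
have cfin : c \is a fin_num.
  rewrite ge0_fin_numE ?ltW// (le_lt_trans (cz 0%N))//.
  by rewrite -ge0_fin_numE ?fin_num_measure.
have fc0 : (0 < fine c)%R by rewrite fine_gt0// c0 ltey_eq cfin.
have [K Kz Kcard] := infinite_set_fset (Num.bound (fine c)^-1) infz.
have KE : [set` K] = \bigcup_(y in [set` K]) [set y].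
  by apply/seteqP; split=> [y Ky|y [x Kx ->]//]; exists y.
suff : 1 < mu [set` K].
  rewrite ltNge probability_le1// KE.
  by apply: fin_bigcup_measurable => // *; exact: borel_point.
rewrite KE measure_fin_bigcup//; last 2 first.
  by move=> x y _ _ [w [/= -> ->]].
  by move=> y _; exact: borel_point.
rewrite fsbig_finite//= set_fsetK.
rewrite (@lt_le_trans _ _ (\sum_(y <- K) c))//; last first.
  rewrite big_seq [leRHS]big_seq; apply: lee_sum => y yK.
  by apply: tail_invariant_point_ge ti cz _; exact: Kz.
rewrite -(fineK cfin) sumEFin lte_fin big_const_seq count_predT iter_addr_0.
rewrite -mulr_natr -ltr_pdivrMl// mulr1.
by rewrite (lt_le_trans (archi_boundP _)) ?ler_nat// invr_ge0 ltW.
Qed.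

(** If [A] is an atom, every measurable set meets [A] in mass 0 or [mu A]. By
    countable additivity one of the children of a cylinder that carries the
    whole of [A] carries it as well, so there is a path all of whose cylinders
    have mass at least [mu A]. *)
Lemma tail_invariant_non_atomic :
  (forall x, infinite_set [set y | tail_equiv x y]) ->
  tail_invariant mu -> non_atomic mu.
Proof.
move=> infx ti A mA A0; apply: contrapT => atomA.
pose P (n : nat) (C : set (path_space B)) := mu (A `&` C) = mu A.
have dich (C : set (borel_path_space B)) : measurable C ->
    mu (A `&` C) = 0 \/ mu (A `&` C) = mu A.
  move=> mC; have mAC : measurable (A `&` C) by exact: measurableI.
  apply: contrapT => /not_orP[/eqP AC0 /eqP ACA]; apply: atomA.
  exists (A `&` C); split => //; apply/andP; split.
    by rewrite lt0e AC0 measure_ge0.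
  by rewrite lt_neqAle ACA le_measure ?inE.
have [z zP] : exists z, forall n, P n (cyl n z).
  apply: path_of_prefixes => [|n x].
    apply: contrapT => /forallNP noP; move: A0.
    rewrite (measure_split_sources mu mA) esum1 ?ltxx// => v _.
    have [x xv] := path_from B v.
    have -> : [set y : path_space B | src (y 0%N) = v] = cyl 0 x.
      by apply/seteqP; split=> y; rewrite cyl0E xv.
    by have [//|/noP] := dich _ (borel_cyl 0 x).
  rewrite /P => xA; apply: contrapT => /forall2NP noP; move: A0.
  rewrite -xA (measure_split_edges mu n (measurableI _ _ mA (borel_cyl n x))).
  rewrite esum1 ?ltxx// => e _.
  have [->|/set0P[y [[_ xy] /= ye]]] :=
      eqVneq (A `&` cyl n x `&` [set y | y n = e]) set0.
    by rewrite measure0.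
  rewrite -setIA -(cyl_eq xy) -ye -cylS.
  by have [//|yP] := dich _ (borel_cyl n.+1 y); case: (noP y).
have [n] := infinite_tail_class_cyl_lt ti (infx z) A0.
by rewrite ltNge -(zP n) le_measure ?inE//; exact: measurableI.
Qed.

End non_atomicity.

(** * The measure defined by coherent weights *)

(** A copy of the path space that carries the algebra of the sets depending on
    finitely many edges. The cylinders themselves do not form a semiring: the
    difference of two cylinders is in general an infinite union of cylinders,
    as a vertex may emit infinitely many edges. *)
Definition determined_algebra (V : nat -> countType) (B : gbd V) : Type :=
  path_space B.

Section determined_algebra.
Context (V : nat -> countType) (B : gbd V).

Let cylindrical := [set A : set (path_space B) | exists n, determined n A].

Let cylindrical0 : cylindrical set0.
Proof. by exists 0; exact: determined0. Qed.

Let cylindricalC : setC_closed cylindrical.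
Proof. by move=> A [n dA]; exists n; exact: determinedC. Qed.

Let cylindricalU : setU_closed cylindrical.
Proof.
move=> A C [m dA] [n dC]; exists (maxn m n); apply: determinedU.
  exact: determined_leq (leq_maxl _ _) dA.
exact: determined_leq (leq_maxr _ _) dC.
Qed.

HB.instance Definition _ := Pointed.on (determined_algebra B).
HB.instance Definition _ := @isAlgebraOfSets.Build default_measure_display
  (determined_algebra B) cylindrical cylindrical0 cylindricalU cylindricalC.

End determined_algebra.

Section content.
Context (R : realType) (V : nat -> countType) (B : gbd V).
Context (W : coherent_weights R B).
Implicit Types (x y z : path_space B) (A C D : set (path_space B)).
Local Open Scope ereal_scope.

(** The chosen path depends only on the set [cyl n x], hence only on the
    prefix of [x]. *)
Definition representative n x : path_space B := get (cyl n x).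

Lemma cyl_representative n x : cyl n x (representative n x).
Proof. by rewrite /representative; apply: getPex; exists x; exact: cyl_refl. Qed.

Lemma representative_eq n x y :
  cyl n x y <-> representative n x = representative n y.
Proof.
split=> [xy|xy]; first by rewrite /representative (cyl_eq xy).
apply: (cyl_trans (cyl_representative n x)); rewrite xy.
exact/cyl_sym/cyl_representative.
Qed.

Definition representatives n := [set x | representative n x = x].

Lemma representatives_inj n x y : representatives n x -> representatives n y ->
  cyl n x y -> x = y.
Proof. by move=> xr yr /representative_eq; rewrite xr yr. Qed.

Lemma representativeK n x : representatives n (representative n x).
Proof. by apply/esym/representative_eq; exact: cyl_representative. Qed.

(** The mass of [A] at resolution [n], meaningful when [A] is determined by
    [n] edges. *)
Definition level_mass n A :=
  \esum_(x in representatives n `&` A) (W n (src (x n)))%:E.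

Let W0 n x : 0 <= (W n (src (x n)))%:E. Proof. by rewrite lee_fin wt_ge0. Qed.

Lemma level_mass_cyl n x : level_mass n (cyl n x) = (W n (src (x n)))%:E.
Proof.
rewrite /level_mass (_ : _ `&` _ = [set representative n x]).
  by rewrite esum_set1// (cyl_src (cyl_representative n x)).
apply/seteqP; split=> [y [yr xy]|_ ->].
  by rewrite /= -yr; exact/esym/representative_eq.
by split; [exact: representativeK|exact: cyl_representative].
Qed.

(** This holds at every resolution [m], because it only groups the
    representatives of level [m] by their prefixes of length [n]. *)
Lemma level_mass_split n m A C : determined n C ->
  level_mass m (A `&` C) =
  \esum_(x in representatives n `&` C) level_mass m (A `&` cyl n x).
Proof.
move=> dC; rewrite /level_mass (@esum_fiber R _ _ (representative n))//.
rewrite [RHS]esum_mkcond; apply: eq_esum => x _.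
case: ifPn => [/set_mem[xr Cx]|].
  congr esum; apply/seteqP; split=> [y [[ym [Ay _]] /= yx]|y [ym [Ay xy]]].
    by do 2!split => //; apply/representative_eq; rewrite yx xr.
  split; last by rewrite /= -((representative_eq n x y).1 xy).
  by do 2!split => //; exact: dC xy Cx.
rewrite notin_setE => xn; rewrite (_ : _ `&` _ = set0) ?esum_set0//.
apply/seteqP; split=> // y [[_ [_ Cy]] /= yx]; apply: xn; rewrite -yx.
split; first exact: representativeK.
exact: dC (cyl_representative n y) Cy.
Qed.

(** The representatives of level [n + 1] with the prefix of [x] are indexed by
    the edges that leave the end of this prefix, so this is the splitting rule
    of the weights. *)
Lemma level_mass_children n x :
  level_mass n.+1 (cyl n x) = (W n (src (x n)))%:E.
Proof.
rewrite -wt_split /level_mass.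
rewrite [RHS](reindex_esum (representatives n.+1 `&` cyl n x) _
  (fun y => y n)); first by apply: eq_esum => y _; rewrite path_compat.
split=> [y [_ /cyl_src//]|y z /set_mem[yr xy] /set_mem[zr xz] yz|e /= ex].
  apply: (representatives_inj yr zr); rewrite cylS (cyl_eq xy).
  by split => //=; rewrite yz.
have [y [xy ye]] := extend_prefix ex.
have yr := cyl_representative n.+1 y.
exists (representative n.+1 y); last by rewrite -ye; apply: yr.2.
split; first exact: representativeK.
exact: cyl_trans xy (sub_cyl (leqnSn n) yr).
Qed.

(** By induction on the resolution: splitting [A] into cylinders of the
    coarser level reduces the claim to [level_mass_children]. *)
Lemma level_mass_leq n m A : (n <= m)%N -> determined n A ->
  level_mass m A = level_mass n A.
Proof.
move=> /subnKC <-; elim: (m - n)%N => [|k IH] dA; first by rewrite addn0.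
have dkA : determined (n + k) A by exact: determined_leq (leq_addr _ _) dA.
rewrite addnS -(IH dA) -[X in level_mass _ X = _]setTI (level_mass_split _ _ dkA).
by apply: eq_esum => x _; rewrite setTI level_mass_children.
Qed.

(** Any resolution that determines [A] may be chosen, by [massE]. *)
Definition mass (A : set (determined_algebra B)) : \bar R :=
  level_mass (get [set n | determined n A]) A.

Lemma massE n A : determined n A -> mass A = level_mass n A.
Proof.
move=> dA; rewrite /mass; set m := get _.
have dmA : determined m A by apply: (@getPex _ [set n | determined n A]); exists n.
by have [/level_mass_leq->|/ltnW/level_mass_leq->] := leqP n m.
Qed.

Lemma mass_cyl n x : mass (cyl n x) = (W n (src (x n)))%:E.
Proof. by rewrite (massE (@determined_cyl _ _ n x)) level_mass_cyl. Qed.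

Lemma mass_split k n D C : determined k D -> determined n C ->
  mass (D `&` C) =
  \esum_(x in representatives n `&` C) mass (D `&` cyl n x).
Proof.
move=> dD dC; have km := leq_maxl k n; have nm := leq_maxr k n.
rewrite (massE (n := maxn k n)); last first.
  by apply: determinedI; [exact: determined_leq dD|exact: determined_leq dC].
rewrite (level_mass_split _ _ dC); apply: eq_esum => x _.
rewrite (massE (n := maxn k n))//; apply: determinedI.
  exact: determined_leq dD.
exact: determined_leq nm (@determined_cyl _ _ n x).
Qed.

Lemma mass_setT : mass setT = 1.
Proof.
rewrite (massE (@determinedT _ _ 0)) /level_mass setIT -(wt_total W).
rewrite [RHS](reindex_esum (representatives 0) _ (fun x => src (x 0%N)))//.
split=> [//|x y /set_mem xr /set_mem yr xy|v _].
  by apply: (representatives_inj xr yr); apply/cyl0E; rewrite xy.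
have [x xv] := path_from B v; exists (representative 0 x).
  exact: representativeK.
by rewrite /= (cyl_src (cyl_representative 0 x)).
Qed.

Let mass0 : mass set0 = 0.
Proof. by rewrite (massE (@determined0 _ _ 0)) /level_mass setI0 esum_set0. Qed.

Let mass_ge0 A : 0 <= mass A. Proof. exact: esum_ge0. Qed.

Let mass_additive : measure_function.semi_additive mass.
Proof.
apply/(additive2P mass0) => A C [m dA] [n dC] AC0.
have {}dA := determined_leq (leq_maxl m n) dA.
have {}dC := determined_leq (leq_maxr m n) dC.
rewrite !(massE dA, massE dC, massE (determinedU dA dC)) /level_mass.
rewrite (esumID A)//; congr (_ + _); congr esum.
  by apply/seteqP; split=> [x [[xr _] Ax]//|x [xr Ax]]; do 2!split => //; left.
apply/seteqP; split=> [x [[xr []// Cx]]//|x [xr Cx]].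
split; first by split => //; right.
by move=> Ax; have : (A `&` C) x by []; rewrite AC0.
Qed.

HB.instance Definition _ := isContent.Build _ _ _ mass mass_ge0 mass_additive.

(** If the sum of the masses of the [F k] were less than the mass of [A], the
    same would hold inside the cylinders around some path [z]. The level
    determining [A] shows that [z] is in [A]; then [z] is in some [F k], and
    inside the cylinder around [z] at a level determining [F k] the set [F k]
    alone has at least the mass of [A]. *)
Lemma mass_sigma_subadditive : measurable_subset_sigma_subadditive mass.
Proof.
move=> A F mF mA AF; rewrite leNgt; apply/negP => FA.
(* Otherwise the opposite inequalities in the cylinders of level n add up. *)
have step n C : determined n C ->
    \sum_(k <oo) mass (F k `&` C) < mass (A `&` C) -> exists2 x, C x &
    \sum_(k <oo) mass (F k `&` cyl n x) < mass (A `&` cyl n x).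
  move=> dC FAC; apply: contrapT => /forall2NP noP; move: FAC; rewrite ltNge.
  move=> /negP; apply; have [kA dA] := mA.
  rewrite (mass_split dA dC) (eq_eseriesr (g := fun k =>
    \esum_(x in representatives n `&` C) mass (F k `&` cyl n x))); last first.
    by move=> k _; have [kF dF] := mF k; rewrite (mass_split dF dC).
  rewrite nneseries_esumT; last by move=> k; exact: esum_ge0.
  under [leRHS]eq_esum => k _ do rewrite esum_mkcond.
  rewrite esum_exchange; last by move=> k x; case: ifP.
  rewrite [leLHS]esum_mkcond; apply: le_esum => x _.
  case: ifPn => [/set_mem[_ Cx]|_].
    by rewrite -nneseries_esumT// leNgt; apply/negP; have [|] := noP x.
  by apply: esum_ge0.
pose P (n : nat) C : Prop :=
  \sum_(k <oo) mass (F k `&` C) < mass (A `&` C).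
have [z zP] : exists z, forall n, P n (cyl n z).
  apply: (path_of_prefixes (P := P)) => [|n x xP].
    have [|x _ xP] := step 0%N setT (@determinedT _ _ 0); last by exists x.
    by rewrite setIT; under eq_eseriesr do rewrite setIT.
  have dxS := determined_leq (leqnSn n) (@determined_cyl _ _ n x).
  by have [y xy yP] := step n.+1 _ dxS xP; exists y.
have [nA dA] := mA.
have Az : A z.
  apply: contrapT => nAz; have := zP nA; rewrite /P (_ : A `&` _ = set0).
    by rewrite mass0 ltNge => /negP; apply; exact: nneseries_ge0.
  by apply/seteqP; split=> // y [Ay /cyl_sym zy]; apply: nAz; exact: dA zy Ay.
have [k _ Fz] := AF z Az; have [n dF] := mF k.
have := zP n; rewrite /P ltNge => /negP; apply.
rewrite (@le_trans _ _ (mass (F k `&` cyl n z)))//.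
  apply: le_measure; rewrite ?inE.
  - by apply: measurableI => //; exists n; exact: determined_cyl.
  - by apply: measurableI => //; exists n; exact: determined_cyl.
  - by move=> y [_ zy]; split => //; exact: dF zy Fz.
rewrite nneseries_esumT//; apply: esum_ge; exists [set k].
  by split.
by rewrite fsbig_set1.
Qed.

HB.instance Definition _ := Content_SigmaSubAdditive_isMeasure.Build _ _ _
  mass mass_sigma_subadditive.

(** Every open set is a countable union of sets of the algebra. *)
Lemma borel_sub_determined_sigma : @measurable _ (borel_path_space B) `<=`
  <<s @measurable _ (determined_algebra B) >>.
Proof.
apply: smallest_sub; first exact: smallest_sigma_algebra.
move=> U /open_bigcup_determined[F dF ->].
apply: (@bigcupT_measurable _
  (g_sigma_algebraType (@measurable _ (determined_algebra B)))) => n.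
by apply: sub_sigma_algebra; exists n; exact: dF.
Qed.

Definition path_measure (A : set (borel_path_space B)) : \bar R :=
  measure_extension mass A.

Lemma path_measure_determined n A : determined n A -> path_measure A = mass A.
Proof.
move=> dA; rewrite /path_measure /measure_extension.
by rewrite measurable_mu_extE//; exists n.
Qed.

Let path_measure0 : path_measure set0 = 0.
Proof. exact: measure0. Qed.

Let path_measure_ge0 A : 0 <= path_measure A.
Proof. exact: measure_ge0. Qed.

Let path_measure_sigma_additive : semi_sigma_additive path_measure.
Proof.
move=> F mF tF mUF.
apply: (@measure_semi_sigma_additive _ _ _ (measure_extension mass)) => //.
  by move=> k; apply: borel_sub_determined_sigma; exact: mF.
exact: borel_sub_determined_sigma.
Qed.

HB.instance Definition _ := isMeasure.Build _ _ _ path_measure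
  path_measure0 path_measure_ge0 path_measure_sigma_additive.

Let path_measureT : path_measure setT = 1.
Proof. by rewrite (path_measure_determined (@determinedT _ _ 0)) mass_setT. Qed.

HB.instance Definition _ :=
  Measure_isProbability.Build _ _ _ path_measure path_measureT.

Lemma path_measure_cylinder n (w : V n) (p : fin_path B w) :
  path_measure (cylinder p) = (W n w)%:E.
Proof.
have [x xw ->] := cylinder_cyl p.
by rewrite (path_measure_determined (@determined_cyl _ _ n x)) mass_cyl xw.
Qed.

End content.

(** * The correspondence *)

Theorem theorem8p13 (R : realType) (V : nat -> countType) :
  (forall (B : gbd V) (mu : probability (borel_path_space B) R),
     standing_assumptions B -> non_atomic mu -> tail_invariant mu ->
     exists (lam : nat -> R) (muh Hh : forall n, V n -> R),
       (forall n, 1 < lam n) /\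
       eigen_conditions (fun n => imx_tr (@incidence V B n)) lam muh Hh)
  /\
  (forall (A : forall n, V n -> V n.+1 -> nat) (lam : nat -> R)
      (muh Hh : forall n, V n -> R),
     (forall n (v : V n.+1),
        (\esum_(w in [set: V n]) ((A n w v)%:R : R)%:E < +oo)%E) ->
     (forall n, 1 < lam n) ->
     (forall n v, 0 <= muh n v) ->
     (forall n v, 0 < Hh n v) ->
     (forall v, Hh 0%N v = 1) ->
     eigen_conditions A lam muh Hh ->
     forall B : gbd V, standing_assumptions B ->
       (forall n, @incidence V B n = imx_tr (A n)) ->
       exists mu : probability (borel_path_space B) R,
         [/\ non_atomic mu, tail_invariant mu &
             forall n (w : V n) (p : fin_path B w),
               mu (cylinder p) = ((\prod_(i < n) lam i)^-1 * muh n w)%:E]).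
Proof.
split.
  move=> B mu _ _ /weights_of_tail_invariant[W].
  exists (fun=> 2), (fun n v => 2 ^+ n * W n v).
  exists (fun n v => 2 ^- n * height R B v).
  by split=> [n|]; [rewrite ltr1n|exact: eigen_of_weights].
move=> A lam muh Hh _ lam1 muh0 _ Hh0 eig B [_ infB _] FA.
have lam0 n : 0 < lam n := lt_trans ltr01 (lam1 n).
have [W WE] := weights_of_eigen lam0 muh0 Hh0 eig FA.
have ti : tail_invariant (path_measure W).
  by move=> n w p q; rewrite !path_measure_cylinder.
exists (path_measure W); split => //.
  exact: tail_invariant_non_atomic.
by move=> n w p; rewrite -WE; exact: path_measure_cylinder.
Qed.
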